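(* Let $(\mathbb{M},d)$ be a metric space and let $(\mathbf{Top}\downarrow\mathbb{M})$ be the category of $\mathbb{M}$-spaces with the flow $\widehat{\mathcal{T}}$ given by $\widehat{\mathcal{T}}_\varepsilon(\mathbb{X},f)=(\mathcal{Q}_\varepsilon(\mathbb{X},f),p_2)$, $\mathcal{Q}_\varepsilon(\mathbb{X},f)=\{(x,m)\in\mathbb{X}\times\mathbb{M}\mid d(f(x),m)\le\varepsilon\}$ (with the full structure described in the context). Then the interleaving distance $d_{((\mathbf{Top}\downarrow\mathbb{M}),\widehat{\mathcal{T}})}$ coincides with the distance $d_\infty$: for all $\mathbb{M}$-spaces $(\mathbb{X},f)$ and $(\mathbb{Y},g)$, $$d_{((\mathbf{Top}\downarrow\mathbb{M}),\widehat{\mathcal{T}})}((\mathbb{X},f),(\mathbb{Y},g))=d_\infty((\mathbb{X},f),(\mathbb{Y},g)).$$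
   Context: $(\mathbf{Top}\downarrow\mathbb{M})$ is the slice category: objects ($\mathbb{M}$-spaces) are pairs $(\mathbb{X},f)$ with $\mathbb{X}$ a topological space and $f:\mathbb{X}\to\mathbb{M}$ continuous; morphisms $\phi:(\mathbb{X},f)\to(\mathbb{Y},g)$ are continuous maps $\phi:\mathbb{X}\to\mathbb{Y}$ with $g\circ\phi=f$. $d_\infty((\mathbb{X},f),(\mathbb{Y},g))=\inf_{\Phi}\sup_{x\in\mathbb{X}}d(f(x),g(\Phi(x)))$, where $\Phi$ runs over all homeomorphisms $\Phi:\mathbb{X}\to\mathbb{Y}$ and suprema are taken in $[0,\infty]$; it is $\infty$ if $\mathbb{X},\mathbb{Y}$ are not homeomorphic. A flow $\mathcal{T}=(\mathcal{T},u,\mu)$ on a category $\mathcal{C}$ consists of: a functor $\mathcal{T}:([0,\infty),\le)\to\mathrm{End}(\mathcal{C})$, $\varepsilon\mapsto\mathcal{T}_\varepsilon$ (with $\mathcal{T}_{(\varepsilon\le\zeta)}:\mathcal{T}_\varepsilon\Rightarrow\mathcal{T}_\zeta$ the natural transformation assigned to $\varepsilon\le\zeta$); a natural transformation $u:I_{\mathcal{C}}\Rightarrow\mathcal{T}_0$; and natural transformations $\mu_{\varepsilon,\zeta}:\mathcal{T}_\varepsilon\mathcal{T}_\zeta\Rightarrow\mathcal{T}_{\varepsilon+\zeta}$ for all $\varepsilon,\zeta\ge0$; such that for all $\varepsilon,\zeta,\delta,\kappa\ge 0$: (i) $\mu_{0,\varepsilon}\circ(u\,\mathcal{T}_\varepsilon)=\mathrm{id}_{\mathcal{T}_\varepsilon}$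 and $\mu_{\varepsilon,0}\circ(\mathcal{T}_\varepsilon u)=\mathrm{id}_{\mathcal{T}_\varepsilon}$; (ii) $\mu_{\varepsilon,\zeta+\delta}\circ(\mathcal{T}_\varepsilon\mu_{\zeta,\delta})=\mu_{\varepsilon+\zeta,\delta}\circ(\mu_{\varepsilon,\zeta}\mathcal{T}_\delta)$; (iii) $\mu_{\delta,\kappa}\circ(\mathcal{T}_{(\varepsilon\le\delta)}\mathcal{T}_{(\zeta\le\kappa)})=\mathcal{T}_{(\varepsilon+\zeta\le\delta+\kappa)}\circ\mu_{\varepsilon,\zeta}$ whenever $\varepsilon\le\delta$ and $\zeta\le\kappa$. A weak $\varepsilon$-interleaving of objects $a,b$ of $\mathcal{C}$ is a pair of morphisms $\varphi:a\to\mathcal{T}_\varepsilon b$, $\psi:b\to\mathcal{T}_\varepsilon a$ such that $\mu_{\varepsilon,\varepsilon,a}\circ\mathcal{T}_\varepsilon\psi\circ\varphi=\mathcal{T}_{(0\le2\varepsilon),a}\circ u_a$ and $\mu_{\varepsilon,\varepsilon,b}\circ\mathcal{T}_\varepsilon\varphi\circ\psi=\mathcal{T}_{(0\le2\varepsilon),b}\circ u_b$. The interleaving distance is $d_{(\mathcal{C},\mathcal{T})}(a,b)=\inf\{\varepsilon\ge0\mid \text{there is a weak }\varepsilon\text{-interleaving of }a,b\}$, with value $\infty$ if there is none for any $\varepsilon$. The flow $(\widehat{\mathcal{T}},\widehat{u},\widehat{\mu})$ on $(\mathbf{Top}\downarrow\mathbb{M})$: $\widehat{\mathcal{T}}_\varepsilon(\mathbb{X},f)=(\mathcal{Q}_\varepsilon(\mathbb{X},f),p_2)$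 with $\mathcal{Q}_\varepsilon(\mathbb{X},f)$ given the subspace topology from $\mathbb{X}\times\mathbb{M}$ and $p_2(x,m)=m$; $\widehat{\mathcal{T}}_\varepsilon[\phi](x,m)=(\phi(x),m)$; $\widehat{\mathcal{T}}_{(\varepsilon\le\zeta)}:(x,m)\mapsto(x,m)$; $\widehat{u}:(\mathbb{X},f)\to(\mathcal{Q}_0(\mathbb{X},f),p_2)$, $x\mapsto(x,f(x))$; $\widehat{\mu}_{\varepsilon,\zeta}:(\mathcal{Q}_\varepsilon(\mathcal{Q}_\zeta(\mathbb{X},f),p_2),p_2)\to(\mathcal{Q}_{\varepsilon+\zeta}(\mathbb{X},f),p_2)$, $((x,t),s)\mapsto(x,s)$. *)

(* Defs.v *)
From HB Require Import structures.
From mathcomp Require Import all_boot all_order all_algebra.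
From mathcomp Require Import all_classical all_reals.
From mathcomp Require Import interval_inference ereal topology.

Set Implicit Arguments.
Unset Strict Implicit.
Unset Printing Implicit Defensive.
Import Order.TTheory GRing.Theory Num.Theory.
Local Open Scope classical_set_scope.
Local Open Scope ring_scope.

Record category := Category {
  ob :> Type;
  mor : ob -> ob -> Type;
  idm : forall a, mor a a;
  compm : forall a b c, mor b c -> mor a b -> mor a c;
  compm_idl : forall a b (f : mor a b), compm (idm b) f = f;
  compm_idr : forall a b (f : mor a b), compm f (idm a) = f;
  compmA : forall a b c d (h : mor c d) (g : mor b c) (f : mor a b),
    compm h (compm g f) = compm (compm h g) f }.

Declare Scope flow_scope.
Delimit Scope flow_scope with flow.
Notation "g ∘ f" := (compm g f) (at level 40, left associativity) : flow_scope.
Local Open Scope flow_scope.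

Record endofunctor (C : category) := Endofunctor {
  fob :> C -> C;
  fmap : forall a b : C, mor a b -> mor (fob a) (fob b);
  fmap_id : forall a : C, fmap (idm a) = idm (fob a);
  fmap_comp : forall (a b c : C) (g : mor b c) (f : mor a b),
    fmap (g ∘ f) = fmap g ∘ fmap f }.

Definition id_functor (C : category) : endofunctor C :=
  @Endofunctor C (fun a => a) (fun _ _ f => f)
    (fun _ => erefl) (fun _ _ _ _ _ => erefl).

Section CompFunctor.
Variables (C : category) (F G : endofunctor C).

Lemma comp_functor_id (a : C) : fmap F (fmap G (idm a)) = idm (F (G a)).
Proof. by rewrite !fmap_id. Qed.

Lemma comp_functor_comp (a b c : C) (g : mor b c) (f : mor a b) :
  fmap F (fmap G (g ∘ f)) = fmap F (fmap G g) ∘ fmap F (fmap G f).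
Proof. by rewrite !fmap_comp. Qed.

Definition comp_functor : endofunctor C :=
  @Endofunctor C (fun a => F (G a)) (fun _ _ f => fmap F (fmap G f))
    comp_functor_id comp_functor_comp.

End CompFunctor.

Record nat_trans (C : category) (F G : endofunctor C) := NatTrans {
  component :> forall a : C, mor (F a) (G a);
  naturality : forall (a b : C) (f : mor a b),
    component b ∘ fmap F f = fmap G f ∘ component a }.

(* The isomorphism F i a -> F j a given by transport along i = j; it mediates
   between indices such as 0 + e and e, which are equal but not convertible. *)
Definition transport_mor (C : category) (I : Type) (F : I -> endofunctor C)
    (i j : I) (e : i = j) (a : C) : mor (F i a) (F j a) :=
  match e in _ = k return mor (F i a) (F k a) with erefl => idm (F i a) end.

Section NonnegAdd.
Variable R : realType.
Implicit Types e z d k : {nonneg R}.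

Definition nn0 : {nonneg R} := 0%:nng.
Definition nnadd e z : {nonneg R} := (e%:num + z%:num)%:nng.

Lemma nnadd0l e : nnadd nn0 e = e.
Proof. by apply: val_inj; rewrite /= add0r. Qed.

Lemma nnadd0r e : nnadd e nn0 = e.
Proof. by apply: val_inj; rewrite /= addr0. Qed.

Lemma nnaddA e z d : nnadd e (nnadd z d) = nnadd (nnadd e z) d.
Proof. by apply: val_inj; rewrite /= addrA. Qed.

Lemma nn0_le e : nn0 <= e.
Proof. by rewrite -num_le /=. Qed.

Lemma nnadd_le e z d k : e <= d -> z <= k -> nnadd e z <= nnadd d k.
Proof. by rewrite -!num_le /=; exact: lerD. Qed.

End NonnegAdd.
Arguments nn0 {R}.

Section Flow.
Variables (R : realType) (C : category).

(* Equations between natural transformations are stated componentwise. At an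
   object a, writing T for flow_fun and u for flow_unit: the component of u T_e
   is u (T e a), that of T_e u is fmap (T e) (u a), and that of the horizontal
   composite T_(e <= d) T_(z <= k) is
   flow_le ed (T k a) ∘ fmap (T e) (flow_le zk a). *)
Record flow := Flow {
  flow_fun :> {nonneg R} -> endofunctor C;
  flow_le : forall e z : {nonneg R}, e <= z ->
    nat_trans (flow_fun e) (flow_fun z);
  flow_le_id : forall (e : {nonneg R}) (ee : e <= e) (a : C),
    flow_le ee a = idm (flow_fun e a);
  flow_le_comp : forall (e z d : {nonneg R}) (ez : e <= z) (zd : z <= d)
    (ed : e <= d) (a : C), flow_le ed a = flow_le zd a ∘ flow_le ez a;
  flow_unit : nat_trans (id_functor C) (flow_fun nn0);
  flow_mult : forall e z : {nonneg R},
    nat_trans (comp_functor (flow_fun e) (flow_fun z)) (flow_fun (nnadd e z));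
  flow_mult_unitl : forall (e : {nonneg R}) (a : C),
    transport_mor flow_fun (nnadd0l e) a
      ∘ (flow_mult nn0 e a ∘ flow_unit (flow_fun e a))
    = idm (flow_fun e a);
  flow_mult_unitr : forall (e : {nonneg R}) (a : C),
    transport_mor flow_fun (nnadd0r e) a
      ∘ (flow_mult e nn0 a ∘ fmap (flow_fun e) (flow_unit a))
    = idm (flow_fun e a);
  flow_mult_assoc : forall (e z d : {nonneg R}) (a : C),
    transport_mor flow_fun (nnaddA e z d) a
      ∘ (flow_mult e (nnadd z d) a ∘ fmap (flow_fun e) (flow_mult z d a))
    = flow_mult (nnadd e z) d a ∘ flow_mult e z (flow_fun d a);
  flow_mult_le : forall (e z d k : {nonneg R}) (ed : e <= d) (zk : z <= k)
      (a : C),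
    flow_mult d k a
      ∘ (flow_le ed (flow_fun k a) ∘ fmap (flow_fun e) (flow_le zk a))
    = flow_le (nnadd_le ed zk) a ∘ flow_mult e z a }.

Variable F : flow.

Definition weak_interleaving (e : {nonneg R}) (a b : C)
    (phi : mor a (F e b)) (psi : mor b (F e a)) : Prop :=
  flow_mult F e e a ∘ fmap (F e) psi ∘ phi
    = flow_le F (nn0_le (nnadd e e)) a ∘ flow_unit F a
  /\ flow_mult F e e b ∘ fmap (F e) phi ∘ psi
    = flow_le F (nn0_le (nnadd e e)) b ∘ flow_unit F b.

Definition interleaving_dist (a b : C) : \bar R :=
  ereal_inf [set e%:num%:E | e in
    [set e : {nonneg R} | exists phi psi, @weak_interleaving e a b phi psi]].

End Flow.

Section MSpaces.
Variables (R : realType) (M : metricType R).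

Record mspace := MSpace {
  carrier :> topologicalType;
  proj : carrier -> M;
  proj_continuous : continuous proj }.

Record mmap (X Y : mspace) := MMap {
  mmap_fun :> X -> Y;
  mmap_continuous : continuous mmap_fun;
  mmap_proj : forall x, proj (mmap_fun x) = proj x }.

Lemma mmap_eq (X Y : mspace) (p q : mmap X Y) :
  (forall x, p x = q x) -> p = q.
Proof.
case: p q => [p pc pp] [q qc qp] /= /funext pq.
by subst q; congr MMap; exact: Prop_irrelevance.
Qed.

Definition mmap_id (X : mspace) : mmap X X :=
  @MMap X X idfun (fun x => cvg_id) (fun=> erefl).

Section MMapComp.
Variables (X Y Z : mspace) (q : mmap Y Z) (p : mmap X Y).

Lemma mmap_comp_continuous : continuous (q \o p).
Proof.
by move=> x; apply: continuous_comp; [exact: mmap_continuous|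
  exact: mmap_continuous].
Qed.

Lemma mmap_comp_proj x : proj ((q \o p) x) = proj x.
Proof. by rewrite /= !mmap_proj. Qed.

Definition mmap_comp : mmap X Z := MMap mmap_comp_continuous mmap_comp_proj.

End MMapComp.

Lemma mmap_comp_idl X Y (p : mmap X Y) : mmap_comp (mmap_id Y) p = p.
Proof. exact: mmap_eq. Qed.

Lemma mmap_comp_idr X Y (p : mmap X Y) : mmap_comp p (mmap_id X) = p.
Proof. exact: mmap_eq. Qed.

Lemma mmap_compA X Y Z W (r : mmap Z W) (q : mmap Y Z) (p : mmap X Y) :
  mmap_comp r (mmap_comp q p) = mmap_comp (mmap_comp r q) p.
Proof. exact: mmap_eq. Qed.

Definition mspaces : category :=
  @Category mspace mmap mmap_id (fun X Y Z => @mmap_comp X Y Z)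
    mmap_comp_idl mmap_comp_idr mmap_compA.

Definition thick_set (e : {nonneg R}) (X : mspace) : set (X * M) :=
  [set p | mdist (proj p.1) p.2 <= e%:num].
Arguments thick_set : clear implicits.

Lemma thick_valP e X (p : thick_set e X) :
  mdist (proj (set_val p).1) (set_val p).2 <= e%:num.
Proof. by have := set_valP p. Qed.

Definition thick_pair e (X : mspace) (x : X) (m : M)
    (h : mdist (proj x) m <= e%:num) : thick_set e X :=
  exist _ (x, m) (@mem_set _ (thick_set e X) (x, m) h).

Lemma thick_proj_continuous e X :
  continuous (fun p : thick_set e X => (set_val p).2).
Proof.
move=> p; apply: (@continuous_comp _ _ _ set_val snd).
  exact: initial_continuous.
exact: cvg_snd.
Qed.

Definition thick e X : mspace :=
  MSpace (@thick_proj_continuous e X).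

Lemma thick_eq e X (p q : thick e X) : set_val p = set_val q -> p = q.
Proof. exact: val_inj. Qed.

Lemma thick_fst_continuous e X :
  continuous (fun p : thick e X => (set_val p).1 : X).
Proof.
move=> p; apply: (@continuous_comp _ _ _ set_val fst).
  exact: initial_continuous.
exact: cvg_fst.
Qed.

Lemma continuous_thick_pair (Z X : mspace) e (a : Z -> X) (b : Z -> M)
    (h : forall z, mdist (proj (a z)) (b z) <= e%:num) :
  continuous a -> continuous b ->
  continuous (fun z => thick_pair (h z) : thick e X).
Proof.
move=> ca cb; apply: continuous_comp_initial => z.
exact: (@cvg_pair _ _ _ (nbhs z) (nbhs (a z)) (nbhs (b z)) _ _ _ a b (ca z) (cb z)).
Qed.

Section ThickMap.
Variables (e : {nonneg R}) (X Y : mspace) (phi : mmap X Y).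

Lemma thick_mapP (p : thick e X) :
  mdist (proj (phi (set_val p).1)) (set_val p).2 <= e%:num.
Proof. by rewrite mmap_proj; exact: thick_valP. Qed.

Definition thick_map_fun (p : thick e X) : thick e Y := thick_pair (thick_mapP p).

Lemma thick_map_continuous : continuous thick_map_fun.
Proof.
apply: continuous_thick_pair; last exact: thick_proj_continuous.
move=> p; apply: (@continuous_comp _ _ _ (fun p : thick e X => (set_val p).1)).
  exact: thick_fst_continuous.
exact: mmap_continuous.
Qed.

Definition thick_map : mmap (thick e X) (thick e Y) :=
  @MMap (thick e X) (thick e Y) thick_map_fun thick_map_continuous
    (fun=> erefl).

End ThickMap.

Section ThickFunctor.
Variable e : {nonneg R}.

Lemma thick_map_id (X : mspaces) : thick_map e (idm X) = idm (thick e X : mspaces).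
Proof. by apply: mmap_eq => p; apply/thick_eq/esym/surjective_pairing. Qed.

Lemma thick_map_comp (X Y Z : mspaces) (q : mor Y Z) (p : mor X Y) :
  thick_map e (q ∘ p) = (thick_map e q : @mor mspaces _ _) ∘ thick_map e p.
Proof. by apply: mmap_eq => x; exact: thick_eq. Qed.

Definition thick_functor : endofunctor mspaces :=
  @Endofunctor mspaces (thick e) (@thick_map e) thick_map_id thick_map_comp.

End ThickFunctor.

Section ThickLe.
Variables (e z : {nonneg R}) (ez : e <= z).

Section Component.
Variable X : mspace.

Lemma thick_leP (p : thick e X) :
  mdist (proj (set_val p).1) (set_val p).2 <= z%:num.
Proof. by apply: le_trans (thick_valP p) _; rewrite num_le. Qed.

Definition thick_le_fun (p : thick e X) : thick z X := thick_pair (thick_leP p).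

Lemma thick_le_continuous : continuous thick_le_fun.
Proof.
apply: continuous_thick_pair; last exact: thick_proj_continuous.
exact: thick_fst_continuous.
Qed.

Definition thick_le_map : mmap (thick e X) (thick z X) :=
  @MMap (thick e X) (thick z X) thick_le_fun thick_le_continuous (fun=> erefl).

End Component.

Lemma thick_le_natural (X Y : mspaces) (phi : mor X Y) :
  (thick_le_map Y : @mor mspaces _ _) ∘ fmap (thick_functor e) phi
  = fmap (thick_functor z) phi ∘ (thick_le_map X : @mor mspaces _ _).
Proof. by apply: mmap_eq => x; exact: thick_eq. Qed.

Definition thick_le : nat_trans (thick_functor e) (thick_functor z) :=
  @NatTrans mspaces (thick_functor e) (thick_functor z) thick_le_map
    thick_le_natural.

End ThickLe.

Section ThickUnit.

Section Component.
Variable X : mspace.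

Lemma thick_unitP (x : X) : mdist (proj x) (proj x) <= (@nn0 R)%:num.
Proof. by rewrite mdistxx. Qed.

Definition thick_unit_fun (x : X) : thick nn0 X := thick_pair (thick_unitP x).

Lemma thick_unit_continuous : continuous thick_unit_fun.
Proof.
apply: continuous_thick_pair; last exact: proj_continuous.
by move=> x; exact: cvg_id.
Qed.

Definition thick_unit_map : mmap X (thick nn0 X) :=
  @MMap X (thick nn0 X) thick_unit_fun thick_unit_continuous (fun=> erefl).

End Component.

Lemma thick_unit_natural (X Y : mspaces) (phi : mor X Y) :
  (thick_unit_map Y : @mor mspaces _ _) ∘ fmap (id_functor mspaces) phi
  = fmap (thick_functor nn0) phi ∘ (thick_unit_map X : @mor mspaces _ _).
Proof.
apply: mmap_eq => x; apply: thick_eq.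
exact: (congr1 (pair (phi x)) (mmap_proj phi x)).
Qed.

Definition thick_unit : nat_trans (id_functor mspaces) (thick_functor nn0) :=
  @NatTrans mspaces (id_functor mspaces) (thick_functor nn0) thick_unit_map
    thick_unit_natural.

End ThickUnit.

Section ThickMult.
Variables (e z : {nonneg R}).

Section Component.
Variable X : mspace.

Lemma thick_multP (p : thick e (thick z X)) :
  mdist (proj (set_val (set_val p).1).1) (set_val p).2 <= (nnadd e z)%:num.
Proof.
apply: le_trans (metric_triangle _ (set_val (set_val p).1).2 _) _.
rewrite /= addrC; apply: lerD; [exact: (thick_valP p) | exact: thick_valP].
Qed.

Definition thick_mult_fun (p : thick e (thick z X)) : thick (nnadd e z) X :=
  thick_pair (thick_multP p).

Lemma thick_mult_continuous : continuous thick_mult_fun.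
Proof.
apply: continuous_thick_pair; last exact: thick_proj_continuous.
move=> p.
apply: (@continuous_comp _ _ _ (fun p : thick e (thick z X) => (set_val p).1)
  (fun p : thick z X => (set_val p).1 : X)); exact: thick_fst_continuous.
Qed.

Definition thick_mult_map :
    mmap (thick e (thick z X)) (thick (nnadd e z) X) :=
  @MMap (thick e (thick z X)) (thick (nnadd e z) X) thick_mult_fun
    thick_mult_continuous (fun=> erefl).

End Component.

Lemma thick_mult_natural (X Y : mspaces) (phi : mor X Y) :
  (thick_mult_map Y : @mor mspaces _ _)
    ∘ fmap (comp_functor (thick_functor e) (thick_functor z)) phi
  = fmap (thick_functor (nnadd e z)) phi
    ∘ (thick_mult_map X : @mor mspaces _ _).
Proof. by apply: mmap_eq => x; exact: thick_eq. Qed.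

Definition thick_mult :
    nat_trans (comp_functor (thick_functor e) (thick_functor z))
              (thick_functor (nnadd e z)) :=
  @NatTrans mspaces (comp_functor (thick_functor e) (thick_functor z))
    (thick_functor (nnadd e z)) thick_mult_map thick_mult_natural.

End ThickMult.

Lemma transport_thickE (e z : {nonneg R}) (ez : e = z) (X : mspace)
    (p : thick e X) :
  set_val ((transport_mor thick_functor ez X : mmap (thick e X) (thick z X)) p)
  = set_val p.
Proof. by case: z / ez. Qed.

Lemma thick_le_id e (ee : e <= e) (X : mspaces) :
  thick_le ee X = idm (thick_functor e X).
Proof. by apply: mmap_eq => p; apply/thick_eq/esym/surjective_pairing. Qed.

Lemma thick_le_comp e z d (ez : e <= z) (zd : z <= d) (ed : e <= d)
    (X : mspaces) :
  thick_le ed X = thick_le zd X ∘ thick_le ez X.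
Proof. by apply: mmap_eq => p; exact: thick_eq. Qed.

Lemma thick_mult_unitl e (X : mspaces) :
  transport_mor thick_functor (nnadd0l e) X
    ∘ (thick_mult nn0 e X ∘ thick_unit (thick_functor e X))
  = idm (thick_functor e X).
Proof.
apply: mmap_eq => p; apply: thick_eq.
rewrite [LHS]transport_thickE; exact/esym/surjective_pairing.
Qed.

Lemma thick_mult_unitr e (X : mspaces) :
  transport_mor thick_functor (nnadd0r e) X
    ∘ (thick_mult e nn0 X ∘ fmap (thick_functor e) (thick_unit X))
  = idm (thick_functor e X).
Proof.
apply: mmap_eq => p; apply: thick_eq.
rewrite [LHS]transport_thickE; exact/esym/surjective_pairing.
Qed.

Lemma thick_mult_assoc e z d (X : mspaces) :
  transport_mor thick_functor (nnaddA e z d) X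
    ∘ (thick_mult e (nnadd z d) X
       ∘ fmap (thick_functor e) (thick_mult z d X))
  = thick_mult (nnadd e z) d X ∘ thick_mult e z (thick_functor d X).
Proof.
apply: mmap_eq => p; apply: thick_eq; rewrite [LHS]transport_thickE.
(* Both sides compute to this pair; unifying them directly is very slow. *)
by transitivity ((set_val (set_val (set_val p).1).1).1, (set_val p).2).
Qed.

Lemma thick_mult_le e z d k (ed : e <= d) (zk : z <= k) (X : mspaces) :
  thick_mult d k X
    ∘ (thick_le ed (thick_functor k X)
       ∘ fmap (thick_functor e) (thick_le zk X))
  = thick_le (nnadd_le ed zk) X ∘ thick_mult e z X.
Proof. by apply: mmap_eq => p; exact: thick_eq. Qed.

Definition thick_flow : flow R mspaces :=
  @Flow R mspaces thick_functor thick_le thick_le_id thick_le_comp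
    thick_unit thick_mult thick_mult_unitl thick_mult_unitr thick_mult_assoc
    thick_mult_le.

Definition homeomorphism (X Y : topologicalType) (Phi : X -> Y) : Prop :=
  continuous Phi /\
  exists Psi : Y -> X, [/\ continuous Psi, cancel Phi Psi & cancel Psi Phi].

(* The supremum is taken in [0, +oo]: adjoining 0 only matters for empty X,
   where ereal_sup set0 would be -oo. *)
Definition sup_dist (X Y : mspace) (Phi : X -> Y) : \bar R :=
  ereal_sup (0%E |` [set (mdist (proj x) (proj (Phi x)))%:E | x in [set: X]]).

Definition dist_infty (X Y : mspace) : \bar R :=
  ereal_inf [set sup_dist Phi | Phi in [set Phi : X -> Y | homeomorphism Phi]].

End MSpaces.

(* Main.v *)
Require Import Defs.
From mathcomp Require Import all_boot all_order all_algebra.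
From mathcomp Require Import all_classical all_reals topology.
From mathcomp Require Import interval_inference ereal.

(** A morphism of M-spaces from (X, f) to the e-thickening of (Y, g) must
    commute with the projections to M, so it has the form x |-> (Phi x, f x):
    it is nothing but a continuous map Phi : X -> Y with d(g(Phi x), f x) <= e.
    For a pair of such morphisms, with underlying maps Phi and Psi, the first
    interleaving equation compares (Psi (Phi x), f x) with (x, f x), and the
    second does the same over Y. The M-coordinates always agree, so the
    equations say exactly that Phi and Psi are inverse to each other. Hence a
    weak e-interleaving amounts to a homeomorphism that moves the projections
    by at most e ([weak_interleavingP]), and the two distances are infima of
    the same set of values, up to upward closure and the value +oo. *)

Set Implicit Arguments.
Unset Strict Implicit.
Unset Printing Implicit Defensive.
(* Restores [proj], which the libraries define too, to the projection of an
   M-space. *)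
Import Defs.
Import Order.TTheory GRing.Theory Num.Theory.
Local Open Scope classical_set_scope.
Local Open Scope ring_scope.

Section SupDist.
Variables (R : realType) (M : metricType R) (X Y : mspace M).
Implicit Types (Phi : X -> Y) (e : {nonneg R}).

Lemma sup_dist_ge0 Phi : (0 <= sup_dist Phi)%E.
Proof. by apply: ereal_sup_ubound; left. Qed.

Lemma sup_dist_leP Phi e :
  (sup_dist Phi <= e%:num%:E)%E <->
  forall x, mdist (proj x) (proj (Phi x)) <= e%:num.
Proof.
split=> [Phie x|Phie].
  rewrite -lee_fin; apply: le_trans Phie.
  by apply: ereal_sup_ubound; right; exists x.
apply: ge_ereal_sup => _ [->|[x _ <-]]; rewrite lee_fin //; exact: Phie.
Qed.

End SupDist.

Section Interleavings.
Variables (R : realType) (M : metricType R).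
Implicit Types (X Y : mspace M) (e : {nonneg R}).

(** The only M-map to the thickening whose first coordinate is Phi. *)
Definition thick_lift e X Y (Phi : X -> Y) (cPhi : continuous Phi)
    (Phi_le : forall x, mdist (proj (Phi x)) (proj x) <= e%:num) :
    mmap X (thick e Y) :=
  @MMap R M X (thick e Y) (fun x => thick_pair (Phi_le x))
    (continuous_thick_pair cPhi (@proj_continuous R M X)) (fun=> erefl).

Definition underlying e X Y (phi : mmap X (thick e Y)) (x : X) : Y :=
  (set_val (phi x)).1.

Lemma underlying_continuous e X Y (phi : mmap X (thick e Y)) :
  continuous (underlying phi).
Proof.
move=> x; apply: (@continuous_comp _ _ _ phi (fun p => (set_val p).1)).
  exact: mmap_continuous.
exact: thick_fst_continuous.
Qed.

Lemma underlying_dist e X Y (phi : mmap X (thick e Y)) (x : X) :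
  mdist (proj (underlying phi x)) (proj x) <= e%:num.
Proof. by have := thick_valP (phi x); rewrite -(mmap_proj phi x). Qed.

(** The two sides have M-coordinate f x for every phi and psi, so only the
    first coordinate carries a condition. *)
Lemma interleaving_eqP e X Y (phi : mmap X (thick e Y))
    (psi : mmap Y (thick e X)) :
  compm (compm (flow_mult (thick_flow M) e e X)
               (fmap (thick_flow M e) (psi : @mor (mspaces M) Y (thick e X))))
        (phi : @mor (mspaces M) X (thick e Y))
    = compm (flow_le (thick_flow M) (nn0_le (nnadd e e)) X)
            (flow_unit (thick_flow M) X)
  <-> cancel (underlying phi) (underlying psi).
Proof.
split=> [eq_mor x|K].
  pose G (h : mmap X (thick (nnadd e e) X)) := underlying h x.
  exact: (congr1 G eq_mor).
apply: mmap_eq => x; apply: thick_eq.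
exact: (congr2 pair (K x) (mmap_proj phi x)).
Qed.

Lemma weak_interleavingP e X Y :
  (exists phi psi, @weak_interleaving R (mspaces M) (thick_flow M) e X Y phi psi)
  <-> exists2 Phi : X -> Y,
        homeomorphism Phi & (sup_dist Phi <= e%:num%:E)%E.
Proof.
split=> [[phi [psi [/interleaving_eqP K /interleaving_eqP K']]]|].
  exists (underlying phi).
    split; first exact: underlying_continuous.
    by exists (underlying psi); split=> //; exact: underlying_continuous.
  by apply/sup_dist_leP => x; rewrite metric_sym; exact: underlying_dist.
move=> [Phi [cPhi [Psi [cPsi K K']]] /sup_dist_leP Phie].
have Phi_le x : mdist (proj (Phi x)) (proj x) <= e%:num.
  by rewrite metric_sym.
have Psi_le y : mdist (proj (Psi y)) (proj y) <= e%:num.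
  by have := Phie (Psi y); rewrite K'.
exists (thick_lift cPhi Phi_le), (thick_lift cPsi Psi_le).
by split; apply/interleaving_eqP.
Qed.

End Interleavings.

Theorem theorem3p14 (R : realType) (M : metricType R) (X Y : mspace M) :
  interleaving_dist (thick_flow M) X Y = dist_infty X Y.
Proof.
apply/eqP; rewrite eq_le; apply/andP; split; apply: le_ereal_inf_tmp.
  move=> _ [Phi hPhi <-].
  (* A finite supremum is itself an interleaving parameter; a supremum equal
     to +oo bounds anything. *)
  have := sup_dist_ge0 Phi; case Er: (sup_dist Phi) => [r| |//] r0; last first.
    by rewrite leey.
  rewrite lee_fin in r0.
  apply: ereal_inf_lbound; exists (NngNum r0) => //.
  by apply/weak_interleavingP; exists Phi; rewrite // Er.
move=> _ [e /weak_interleavingP[Phi hPhi Phie] <-].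
by apply: le_trans Phie; apply: ereal_inf_lbound; exists Phi.
Qed.
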